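(* There exists $n_0$ such that the following holds for all $n=3m\ge n_0$. If $G$ is an $F_{3,2}$-free $3$-graph on $n$ vertices with $\delta_2(G)=m$, then $G\in\mathcal T(n)$ (up to isomorphism).
   Context: A $3$-graph is a pair $(V,E)$ with $E$ a set of $3$-subsets of $V$; $\delta_2(G)$ is the minimum over pairs of distinct vertices of the number of $3$-edges containing the pair. $F_{3,2}$ is the $3$-graph on $\{1,\dots,5\}$ with $3$-edges $123,124,125,345$. For a partition $V=A\sqcup B\sqcup C$, $T_{A,B,C}$ is the $3$-graph on $V$ whose $3$-edges are all triples with two vertices in $A$ and one in $B$, or two in $B$ and one in $C$, or two in $C$ and one in $A$. The family $\mathcal T(3m)$: take disjoint sets $A,B,C$ each of size $m$, with $C=\{1,\dots,m\}$, and a proper edge colouring $\phi$ of the complete bipartite graph with parts $A,B$ using colours from $C$ (edges sharing a vertex get different colours); the member of $\mathcal T(3m)$ associated with $\phi$ has $3$-edges those of $T_{A,B,C}$ together with all triples $abc$ with $a\in A$, $b\in B$, $\phi(ab)=c$. *)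

(* Defs.v *)
From mathcomp Require Import all_boot.
Set Implicit Arguments.
Unset Strict Implicit.
Unset Printing Implicit Defensive.

Record graph3 (V : finType) := Graph3 {
  edges : {set {set V}};
  edges_card3 : forall e, e \in edges -> #|e| = 3
}.

Definition codegree (V : finType) (G : graph3 V) (x y : V) : nat :=
  #|[set e in edges G | [set x; y] \subset e]|.

(* The unit #|V| is never below a codegree, so this is the true minimum as
   soon as V has two distinct vertices (and it is #|V| otherwise). *)
Definition delta2 (V : finType) (G : graph3 V) : nat :=
  \big[minn/#|V|]_(p : V * V | p.1 != p.2) codegree G p.1 p.2.

(* H is a subgraph of G, not necessarily induced, up to relabelling. *)
Definition contains (V W : finType) (G : graph3 V) (H : graph3 W) : Prop :=
  exists2 f : W -> V, injective f &
    forall e, e \in edges H -> f @: e \in edges G.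

Definition free_of (V W : finType) (H : graph3 W) (G : graph3 V) : Prop :=
  ~ contains G H.

Definition isomorphic (V W : finType) (G : graph3 V) (H : graph3 W) : Prop :=
  exists2 f : V -> W, bijective f &
    forall e : {set V}, (f @: e \in edges H) = (e \in edges G).

(* The label k in {1, ..., 5} is the element k - 1 of 'I_5. *)
Definition lab5 (k : nat) : 'I_5 := inord k.-1.

Definition F32_edges : {set {set 'I_5}} :=
  [set [set lab5 1; lab5 2; lab5 3];
       [set lab5 1; lab5 2; lab5 4];
       [set lab5 1; lab5 2; lab5 5];
       [set lab5 3; lab5 4; lab5 5]].

Lemma F32_card3 e : e \in F32_edges -> #|e| = 3.
Proof.
rewrite !inE -!orbA => /or4P[] /eqP->;
  by rewrite -setUA !cardsU1 !inE cards1 /lab5 -!val_eqE /= !inordK.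
Qed.

Definition F32 : graph3 'I_5 := Graph3 F32_card3.

Definition T_edges (V : finType) (A B C : {set V}) : {set {set V}} :=
  [set e : {set V} | (#|e| == 3) &&
     [|| (#|e :&: A| == 2) && (#|e :&: B| == 1),
         (#|e :&: B| == 2) && (#|e :&: C| == 1)
       | (#|e :&: C| == 2) && (#|e :&: A| == 1)]].

(* Three disjoint copies of 'I_m, whose elements stand for 1, ..., m. *)
Definition vert (m : nat) : finType := ('I_m + 'I_m + 'I_m)%type.

Definition vA (m : nat) (a : 'I_m) : vert m := inl (inl a).
Definition vB (m : nat) (b : 'I_m) : vert m := inl (inr b).
Definition vC (m : nat) (c : 'I_m) : vert m := inr c.

Definition partA (m : nat) : {set vert m} := [set vA a | a : 'I_m].
Definition partB (m : nat) : {set vert m} := [set vB b | b : 'I_m].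
Definition partC (m : nat) : {set vert m} := [set vC c | c : 'I_m].

(* A pair (a, b) is the edge of the complete bipartite graph joining the
   vertex a of A to the vertex b of B. *)
Definition proper_colouring (m : nat) (phi : 'I_m * 'I_m -> 'I_m) : Prop :=
  forall e e' : 'I_m * 'I_m,
    e <> e' -> e.1 = e'.1 \/ e.2 = e'.2 -> phi e <> phi e'.

Definition Tphi_edges (m : nat) (phi : 'I_m * 'I_m -> 'I_m) :
    {set {set vert m}} :=
  T_edges (partA m) (partB m) (partC m) :|:
  [set [set vA e.1; vB e.2; vC (phi e)] | e : 'I_m * 'I_m].

Lemma Tphi_card3 (m : nat) (phi : 'I_m * 'I_m -> 'I_m) e :
  e \in Tphi_edges phi -> #|e| = 3.
Proof.
rewrite inE => /orP[|/imsetP[[a b] _ ->]].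
  by rewrite inE => /andP[/eqP].
by rewrite -setUA !cardsU1 !inE cards1.
Qed.

Definition Tphi (m : nat) (phi : 'I_m * 'I_m -> 'I_m) : graph3 (vert m) :=
  Graph3 (@Tphi_card3 m phi).

(* Membership in T(3m), up to isomorphism. *)
Definition in_T_family (m : nat) (V : finType) (G : graph3 V) : Prop :=
  exists2 phi : 'I_m * 'I_m -> 'I_m,
    proper_colouring phi & isomorphic G (Tphi phi).

(* Main.v *)
Require Import Defs.
From mathcomp Require Import all_boot zify.

(* Write [N x y] for the set of [z] such that [xyz] is an edge; freeness of
   [F32] says that every [N x y] is independent.  Hence a pair inside [N x y] has
   its neighbourhood disjoint from [N x y], and three pairs [aa'], [bb'], [cc']
   with [b, b'] in [N a a'], [c, c'] in [N b b'] and [a, a'] in [N c c'] have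
   pairwise disjoint neighbourhoods, of size at least [m] each: these partition
   the [3m] vertices exactly.
   Such pairs come from an extremal choice.  Let [Z S] be the set of vertices
   whose link is empty inside [S], and let [S] maximise
   [#|S| ^ e * d ^ #|Z S|] with [e] a small fraction of [m].  Then every [N u w]
   that meets [S] in a proportion at least [1/d] is contained in [Z S] up to
   [e] vertices.  Taking [X = N s s'] for a suitable pair of [S], double counting
   gives for most [w] in [X] a set [R w] of almost [m] vertices outside [X] that
   is almost disjoint from [N w x] for most [x] in [X]; so all these [N w x] are
   close to one set [C] of size about [m].  If almost all triples of type [XXC] are
   edges and [Q] is the rest, freeness forces almost all triples of type [CCQ],
   and then [QQX], to be edges.
   In the exact partition given by typical pairs, a few vertices might still be
   atypical; but an edge [aa'c] with [a, a'] in [A] and [c] in [C] is impossible,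
   which makes the structure exact. *)

Set Implicit Arguments.
Unset Strict Implicit.
Unset Printing Implicit Defensive.

(** * Extremal choice and double counting *)

(** The edge set as a ternary relation. The five vertices in [sysF] are automatically distinct,
    because [sysxx] and the symmetries exclude repeated vertices in an edge. *)
Record F32_free_system (V : finType) (E : V -> V -> V -> bool) (m : nat) :
    Prop := {
  sysC12 : forall x y z, E x y z = E y x z;
  sysC23 : forall x y z, E x y z = E x z y;
  sysxx : forall x z, E x x z = false;
  sysF : forall x y a b c, E x y a -> E x y b -> E x y c -> E a b c -> False;
  sysdeg : forall x y, x != y -> m <= #|[set z | E x y z]|;
  sysV : #|V| = 3 * m
}.

Lemma exists_le_mean (T : finType) (A : {set T}) (F : T -> nat) b :
  0 < #|A| -> \sum_(i in A) F i <= #|A| * b -> exists2 i, i \in A & F i <= b.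
Proof.
move=> A0 leF; have [/exists_inP[i Ai le] | none] := boolP [exists i in A, F i <= b].
  by exists i.
suff : #|A| * b.+1 <= \sum_(i in A) F i by lia.
rewrite -sum_nat_const; apply: leq_sum => i Ai; rewrite ltnNge.
by apply: contra none => le; apply/exists_inP; exists i.
Qed.

Section System.

Variables (V : finType) (E : V -> V -> V -> bool) (m : nat).
Hypothesis H : F32_free_system E m.

Definition N x y := [set z | E x y z].

Lemma EC13 x y z : E x y z = E z y x.
Proof. by rewrite (sysC12 H) (sysC23 H) (sysC12 H). Qed.

Lemma Erot x y z : E x y z = E y z x.
Proof. by rewrite (sysC12 H) (sysC23 H). Qed.

Lemma E_neq x y z : E x y z -> [/\ x != y, y != z & x != z].
Proof.
move=> Exyz; split; apply/eqP => eq_xy; move: Exyz.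
- by rewrite eq_xy (sysxx H).
- by rewrite eq_xy EC13 (sysxx H).
- by rewrite eq_xy (sysC23 H) (sysxx H).
Qed.

Lemma NC x y : N x y = N y x.
Proof. by apply/setP => z; rewrite !inE (sysC12 H). Qed.

Lemma N_indep x y a b c : a \in N x y -> b \in N x y -> c \in N x y ->
  E a b c = false.
Proof. by rewrite !inE => xa xb xc; apply/negP => /(sysF H xa xb xc). Qed.

Lemma card_NI x y (A : {set V}) : #|N x y :&: A| = \sum_(z in A) E x y z.
Proof.
rewrite -sum1_card big_mkcond [RHS]big_mkcond; apply: eq_bigr => z _.
by rewrite !inE; case: (z \in A); case: (E x y z).
Qed.

Lemma sum_card_NI w (A B : {set V}) :
  \sum_(s in A) #|N w s :&: B| = \sum_(u in B) #|N u w :&: A|.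
Proof.
under eq_bigr do rewrite card_NI.
under [RHS]eq_bigr do rewrite card_NI.
rewrite exchange_big; apply: eq_bigr => u _; apply: eq_bigr => s _.
by rewrite (sysC23 H) (sysC12 H).
Qed.

Definition Z (S : {set V}) :=
  [set w | [forall s in S, forall s' in S, ~~ E w s s']].

Lemma ZP (S : {set V}) w :
  reflect {in S &, forall s s', E w s s' = false} (w \in Z S).
Proof.
rewrite inE; apply: (iffP forall_inP) => [ZSw s s' Ss Ss' | ZSw s Ss].
  by apply/negbTE; have /forall_inP := ZSw s Ss; apply.
by apply/forall_inP => s' Ss'; rewrite ZSw.
Qed.

Lemma N_disjoint_Z (S : {set V}) s s' : s \in S -> s' \in S ->
  [disjoint N s s' & Z S].
Proof.
move=> Ss Ss'; rewrite disjoints_subset; apply/subsetP => w.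
rewrite inE in_setC -Erot => Ew.
by apply/negP => /ZP/(_ _ _ Ss Ss'); rewrite Ew.
Qed.

(* Passing from [S] to [S :&: N u w] puts [N u w] into [Z]; a maximiser of
   [#|S| ^ e * d ^ #|Z S|] does not allow [Z] to grow by more than [e] when [S]
   shrinks by a factor [d]. *)
Lemma exists_stable_set e d : 0 < m -> 0 < e -> 1 < d ->
  exists S : {set V}, [/\ 0 < #|S|, #|V| ^ e <= #|S| ^ e * d ^ #|V| &
    forall u w, #|S| <= d * #|N u w :&: S| -> #|N u w :\: Z S| <= e].
Proof.
move=> m0 e0 d1; have d0 : 0 < d by lia.
pose Psi (S : {set V}) := #|S| ^ e * d ^ #|Z S|.
case: (@arg_maxnP _ [set: V] xpredT Psi isT) => S _ maxS.
have geV : #|V| ^ e <= Psi S.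
  apply: leq_trans (maxS setT isT); rewrite /Psi cardsT.
  by rewrite leq_pmulr // expn_gt0 d0.
have S0 : 0 < #|S|.
  rewrite lt0n; apply/eqP => S0; move: geV; rewrite /Psi S0 exp0n // mul0n.
  by rewrite leqn0 expn_eq0 (sysV H); lia.
exists S; split=> //.
  apply: leq_trans geV _; rewrite leq_mul2l leq_pexp2l ?orbT //.
  exact: max_card.
move=> u w leS; rewrite leqNgt; apply/negP => gte.
have := maxS (N u w :&: S) isT; apply/negP; rewrite -ltnNge /Psi.
have leZ : #|Z S| + e.+1 <= #|Z (N u w :&: S)|.
  apply: leq_trans (_ : #|Z S :|: N u w| <= _).
    have := cardsUI (Z S) (N u w); have := cardsD (N u w) (Z S).
    have := subset_leq_card (subsetIr (Z S) (N u w)).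
    rewrite setIC; lia.
  apply/subset_leq_card/subsetP => z; rewrite in_setU => zZ.
  apply/ZP => s s'; rewrite !in_setI => /andP[Ns Ss] /andP[Ns' Ss'].
  case/orP: zZ => [/ZP -> // | Nz]; exact: N_indep Nz Ns Ns'.
apply: leq_trans (_ : #|N u w :&: S| ^ e * d ^ (#|Z S| + e.+1) <= _); last first.
  by rewrite leq_mul2l leq_pexp2l ?orbT.
have -> : #|N u w :&: S| ^ e * d ^ (#|Z S| + e.+1) =
          (d * #|N u w :&: S|) ^ e * (d * d ^ #|Z S|).
  by rewrite expnMn expnD expnS; lia.
apply: leq_trans (_ : #|S| ^ e * (d * d ^ #|Z S|) <= _).
  by rewrite ltn_mul2l expn_gt0 S0 /= ltn_Pmull // expn_gt0 d0.
by rewrite leq_mul2r leq_exp2r ?leS ?orbT.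
Qed.

(** Stability of [S] applies to the pairs [w], [s] with [s] in [highdeg d S w]; a [good] vertex [w]
    has many such partners. *)
Definition highdeg d (S : {set V}) w :=
  [set s in S | #|S| <= d * #|N w s :&: S|].

Definition good d d' (S : {set V}) w := #|S| <= d' * #|highdeg d S w|.

(** Fewer than [#|S| / d'] vertices have high degree, and each contributes at most [#|S|]; every
    other vertex contributes less than [#|S| / d], hence less than [#|S| / d']. *)
Lemma bad_link_sparse d d' (S : {set V}) w : 0 < d' <= d -> ~~ good d d' S w ->
  d' * \sum_(s in S) #|N w s :&: S| <= 2 * (#|S| * #|S|).
Proof.
case/andP => d'0 led; rewrite -ltnNge => bad.
have d0 : 0 < d by lia.
have le_sum : d * \sum_(s in S) #|N w s :&: S| <=
    d * (#|highdeg d S w| * #|S|) + #|S| * #|S|.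
  rewrite (big_setID (highdeg d S w)) /= mulnDr leq_add //.
    rewrite leq_mul2l; apply/orP; right.
    have -> : S :&: highdeg d S w = highdeg d S w.
      by apply/setIidPr/subsetP => s; rewrite inE => /andP[].
    rewrite -sum_nat_const; apply: leq_sum => s _.
    exact/subset_leq_card/subsetIr.
  rewrite big_distrr /=.
  apply: leq_trans (_ : \sum_(s in S :\: highdeg d S w) #|S| <= _); last first.
    by rewrite sum_nat_const leq_mul2r subset_leq_card ?orbT ?subsetDl.
  apply: leq_sum => s; rewrite !inE => /andP[+ Ss]; rewrite Ss /= -ltnNge.
  exact: ltnW.
rewrite -(leq_pmul2l d0).
apply: leq_trans (_ : d' * (d * (#|highdeg d S w| * #|S|) + #|S| * #|S|) <= _).
  by rewrite mulnCA leq_mul2l le_sum orbT.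
rewrite mulnDr mulnCA (mulnA d') mul2n -addnn mulnDr.
by rewrite leq_add // ?leq_mul2l leq_mul2r ?(ltnW bad) ?led ?orbT.
Qed.

(** Averaging over pairs: each bad [w] is counted once for every ordered pair of its link inside
    [S], and that link is sparse. Discarding the diagonal costs a factor 2, as
    [#|S| <= 2 * #|S|.-1]. *)
Lemma exists_good_pair d d' (S : {set V}) : 0 < d' <= d -> 1 < #|S| ->
  exists s s', [/\ s \in S, s' \in S, s != s' &
    d' * #|[set w in N s s' | ~~ good d d' S w]| <= 4 * #|V|].
Proof.
move=> led S1; pose bad s s' := [set w in N s s' | ~~ good d d' S w].
have [/exists_inP[s Ss /exists_inP[s' Ss' /andP[ne le]]] | none] :=
  boolP [exists s in S, exists s' in S, (s != s') && (d' * #|bad s s'| <= 4 * #|V|)].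
  by exists s, s'.
have gt_bad s s' : s \in S -> s' \in S -> s != s' -> 4 * #|V| < d' * #|bad s s'|.
  move=> Ss Ss' ne; rewrite ltnNge; apply: contra none => le.
  by apply/exists_inP; exists s => //; apply/exists_inP; exists s'; rewrite ?ne.
have up : d' * \sum_(s in S) \sum_(s' in S) #|bad s s'| <=
    #|V| * (2 * (#|S| * #|S|)).
  apply: leq_trans (_ : \sum_(w : V | ~~ good d d' S w)
    d' * \sum_(s in S) #|N w s :&: S| <= _).
    rewrite -[leqRHS]big_distrr leq_mul2l /=; apply/orP; right.
    rewrite [leqRHS]exchange_big; apply: leq_sum => s Ss.
    under [leqRHS]eq_bigr do rewrite card_NI.
    rewrite [leqRHS]exchange_big; apply: leq_sum => s' Ss'.
    rewrite -sum1_card big_mkcond [leqRHS]big_mkcond; apply: leq_sum => w _.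
    by rewrite !inE; case: (good _ _ _ _); rewrite ?andbF ?andbT // -Erot; case: E.
  rewrite -[#|V|]sum1_card big_distrl /= big_mkcond; apply: leq_sum => w _.
  by rewrite mul1n; case: ifP => [bad_w | _]; [exact: (bad_link_sparse led)|].
have low : #|S| * (#|S|.-1 * (4 * #|V|).+1) <=
    d' * \sum_(s in S) \sum_(s' in S) #|bad s s'|.
  rewrite -sum_nat_const big_distrr; apply: leq_sum => s Ss.
  rewrite (bigD1 s) //= mulnDr big_distrr /=.
  apply: leq_trans (leq_addl _ _).
  have -> : #|S|.-1 = #|S :\ s| by rewrite (cardsD1 s S) Ss.
  rewrite -sum_nat_const; under [leqRHS]eq_bigl do rewrite andbC -in_setD1.
  by apply: leq_sum => s'; rewrite !inE => /andP[ne Ss']; rewrite gt_bad // eq_sym.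
move: low up S1; case: #|S| => [|[|k]] //= low up _; nia.
Qed.

(** The set [R w] of the overview. *)
Definition rich d (S : {set V}) w :=
  [set u in Z S | #|S| <= d * #|N u w :&: S|].

Definition stable d e (S : {set V}) :=
  forall u w, #|S| <= d * #|N u w :&: S| -> #|N u w :\: Z S| <= e.

(** Count the pairs of [s] in [T] and [u] in [N w s :&: Z S]. Stability gives at least [m - e] such
    [u] for each [s]; a [u] that is not rich has fewer than [#|S| / d] partners, and
    [#|S| <= d' * #|T|]. Dividing by [#|T|] gives the bound. *)
Lemma card_rich d d' e (S : {set V}) w : 0 < d -> 0 < #|S| -> stable d e S ->
  good d d' S w -> d * m <= d * #|rich d S w| + d * e + d' * (3 * m).
Proof.
move=> d0 S0 stS gw; set T := highdeg d S w.
have T0 : 0 < #|T| by rewrite lt0n; apply: contraTneq gw; rewrite /good -/T => ->; lia.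
have low : #|T| * m <= #|T| * e + \sum_(s in T) #|N w s :&: Z S|.
  rewrite -!sum_nat_const -big_split /=; apply: leq_sum => s.
  rewrite inE => /andP[Ss hi].
  have ne : w != s.
    apply: contraTneq hi => ->; rewrite -ltnNge.
    have -> : N s s = set0 by apply/setP => z; rewrite !inE (sysxx H).
    by rewrite set0I cards0 muln0.
  rewrite addnC; apply: leq_trans (sysdeg H ne) _.
  by rewrite -(cardsID (Z S) (N w s)) leq_add2l; exact: stS.
have up : d * \sum_(s in T) #|N w s :&: Z S| <=
    d * (#|rich d S w| * #|T|) + 3 * m * #|S|.
  rewrite sum_card_NI (big_setID (rich d S w)) /= mulnDr leq_add //.
    rewrite leq_mul2l; apply/orP; right.
    have -> : Z S :&: rich d S w = rich d S w.
      by apply/setIidPr/subsetP => s; rewrite inE => /andP[].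
    rewrite -sum_nat_const; apply: leq_sum => s _.
    exact/subset_leq_card/subsetIr.
  rewrite big_distrr /=.
  apply: leq_trans (_ : \sum_(u in Z S :\: rich d S w) #|S| <= _); last first.
    by rewrite sum_nat_const leq_mul2r -(sysV H) max_card orbT.
  apply: leq_sum => u; rewrite in_setD => /andP[+ Zu].
  rewrite inE Zu /= -ltnNge => /ltnW; apply: leq_trans; rewrite leq_mul2l.
  apply/orP; right; apply/subset_leq_card/setIS/subsetP => s.
  by rewrite inE => /andP[].
have {low} low : d * (#|T| * m) <=
    d * (#|T| * e) + d * \sum_(s in T) #|N w s :&: Z S|.
  by rewrite -mulnDr leq_mul2l low orbT.
have {gw} gw : 3 * m * #|S| <= 3 * m * (d' * #|T|).
  by rewrite leq_mul2l [X in _ || X]gw orbT.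
rewrite -(leq_pmul2l T0) !mulnDr.
move: (\sum_(s in T) _) low up => t low up; lia.
Qed.

(* The degenerate pairs [(x, x)] count as missed. *)
Definition miss (X C : {set V}) :=
  \sum_(x in X) \sum_(x' in X) #|C :\: N x x'|.

(** Let [C w] be the complement of [X :|: R w]. For [w] in [G], [N w x] avoids [X] and mostly avoids
    [R w], so it nearly lies in [C w], and the sizes make the two close. Averaging gives a [w0] for
    which [N w w0] mostly avoids [R w] for typical [w]; comparison through [N w w0 = N w0 w] then
    brings [C w] close to [C w0], which serves as [C], with [Q = R w0]. *)
Lemma near_partition e (X G : {set V}) (R : V -> {set V}) :
    0 < e -> 3 * e < m -> m <= #|X| -> G \subset X -> #|X :\: G| <= 2 * e ->
    {in X &, forall x x', [disjoint N x x' & X]} ->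
    {in G, forall w, [/\ [disjoint R w & X], m <= #|R w| + 2 * e &
      \sum_(x in X) #|N w x :&: R w| <= 2 * m * e]} ->
  exists C Q : {set V}, X :|: C :|: Q = setT /\
    [/\ #|X| + #|C| + #|Q| = 3 * m, m <= #|C| + 3 * e, m <= #|Q| + 3 * e &
      miss X C <= 44 * (m * m * e)].
Proof.
move=> e0 em leX sGX badX disX propG.
pose f w x := #|N w x :&: R w|.
have X2m : #|X| <= 2 * m.
  have /card_gt1P[x [x' [Xx Xx' ne]]] : 1 < #|X| by lia.
  have := max_card (N x x' :|: X); rewrite (sysV H) cardsU.
  have := sysdeg H ne; have := disX _ _ Xx Xx'; rewrite -setI_eq0 => /eqP ->.
  rewrite cards0 -/(N x x'); lia.
have G0 : 0 < #|G|.
  by have := cardsID G X; rewrite (setIidPr sGX); lia.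
have GX : #|G| <= #|X| by exact: subset_leq_card.
have [w0 Gw0 le_w0] : exists2 w0, w0 \in G & \sum_(w in G) f w w0 <= 2 * m * e.
  apply: exists_le_mean => //; rewrite exchange_big -sum_nat_const.
  apply: leq_sum => w Gw; have [_ _] := propG _ Gw; apply: leq_trans.
  by rewrite [leqRHS](big_setID G) /= (setIidPr sGX) leq_addr.
pose C w := ~: (X :|: R w).
have cardC w : w \in G -> #|X| + #|C w| + #|R w| = 3 * m.
  move=> Gw; have [dis _ _] := propG _ Gw.
  have := cardsC (X :|: R w); rewrite cardsU (sysV H).
  have -> : X :&: R w = set0 by apply/eqP; rewrite setIC setI_eq0.
  rewrite cards0 subn0 -/(C w); lia.
have Xw0 : w0 \in X := subsetP sGX _ Gw0.
have [disQ leQ sumQ] := propG _ Gw0.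
have NC' w x : w \in G -> x \in X -> #|N w x :\: C w| <= f w x.
  move=> Gw Xx; apply/subset_leq_card/subsetP => z.
  rewrite in_setD in_setC negbK in_setU => /andP[/orP[Xz | Rz] Nz].
    have := disX _ _ (subsetP sGX _ Gw) Xx.
    by rewrite disjoint_sym => /disjointFr -/(_ _ Xz); rewrite Nz.
  by rewrite in_setI Nz.
have CC w : w \in G -> #|C w :\: C w0| <= 2 * e + f w w0 + f w0 w.
  move=> Gw; have Xw := subsetP sGX _ Gw.
  have [-> | ne] := eqVneq w w0; first by rewrite setDv cards0.
  have := NC' _ _ Gw Xw0; have := NC' _ _ Gw0 Xw.
  have := cardC _ Gw; have [_ leR _] := propG _ Gw.
  have := sysdeg H ne; rewrite -/(N w w0) (NC w0 w).
  have := cardsID (C w) (N w w0); have := cardsID (N w w0) (C w).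
  rewrite (setIC (C w)).
  have : #|C w :\: C w0| <= #|C w :\: N w w0| + #|N w w0 :\: C w0|.
    apply: leq_trans (leq_card_setU _ _).1; apply/subset_leq_card/subsetP => z.
    by rewrite in_setU !in_setD => /andP[-> ->]; rewrite andbT orNb.
  lia.
exists (C w0), (R w0).
split; first by rewrite setUAC setUCr.
split; [exact: cardC | | by lia |].
  (* If [C w0] were smaller, each [N w0 x] with [x != w0] would meet [R w0] in more than [3 * e]
     vertices, against [sumQ]. *)
  rewrite leqNgt; apply/negP => ltC.
  suff : #|X :\ w0| * (3 * e).+1 <= 2 * m * e by have := cardsD1 w0 X; rewrite Xw0; nia.
  apply: leq_trans sumQ; rewrite [leqRHS](bigD1 w0) //= -sum_nat_const.
  apply: leq_trans (leq_addl _ _).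
  under [leqRHS]eq_bigl do rewrite andbC -in_setD1.
  apply: leq_sum => x /[!inE] /andP[ne Xx]; rewrite eq_sym in ne.
  have := NC' _ _ Gw0 Xx; rewrite /f; have := sysdeg H ne; rewrite -/(N w0 x).
  have := cardsID (C w0) (N w0 x); have := subset_leq_card (subsetIr (N w0 x) (C w0)).
  lia.
have C2m : #|C w0| <= 2 * m by have := cardC _ Gw0; lia.
have miss_le x x' : x \in X -> x' \in X ->
    #|C w0 :\: N x x'| <= (2 * e + #|N x x' :\: C w0|) + (x' == x) * (2 * m).
  move=> Xx Xx'; have [-> | ne] := eqVneq x' x.
    apply: leq_trans (leq_addl _ _); rewrite mul1n; apply: leq_trans C2m.
    exact/subset_leq_card/subsetDl.
  rewrite addn0; have := sysdeg H ne; have := cardC _ Gw0.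
  rewrite -/(N x' x) (NC x').
  have := cardsID (C w0) (N x x'); have := cardsID (N x x') (C w0).
  rewrite (setIC (C w0)); lia.
have sumG : \sum_(x in G) \sum_(x' in X) #|N x x' :\: C w0| <= 20 * (m * m * e).
  apply: leq_trans (_ : \sum_(x in G)
    (\sum_(x' in X) f x x' + #|X| * (2 * e + f x w0 + f w0 x)) <= _).
    apply: leq_sum => x Gx; rewrite -sum_nat_const -big_split /=.
    apply: leq_sum => x' Xx'; have := CC _ Gx; have := NC' _ _ Gx Xx'.
    have : #|N x x' :\: C w0| <= #|N x x' :\: C x| + #|C x :\: C w0|.
      apply: leq_trans (leq_card_setU _ _).1; apply/subset_leq_card/subsetP => z.
      by rewrite in_setU !in_setD => /andP[-> ->]; rewrite andbT orNb.
    lia.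
  rewrite big_split /= -big_distrr /= 2!big_split /= sum_nat_const.
  have le1 : \sum_(x in G) \sum_(x' in X) f x x' <= #|G| * (2 * m * e).
    by rewrite -sum_nat_const; apply: leq_sum => x /propG[].
  have le2 : \sum_(x in G) f w0 x <= 2 * m * e.
    by apply: leq_trans sumQ; rewrite [leqRHS](big_setID G) /= (setIidPr sGX) leq_addr.
  have leG : #|G| <= 2 * m by lia.
  have : #|X| * (#|G| * (2 * e) + \sum_(x in G) f x w0 + \sum_(x in G) f w0 x) <=
    (2 * m) * ((2 * m) * (2 * e) + 2 * m * e + 2 * m * e).
    by rewrite leq_mul // !leq_add // leq_mul2r leG orbT.
  have : #|G| * (2 * m * e) <= (2 * m) * (2 * m * e) by rewrite leq_mul2r leG orbT.
  lia.
(* At most [2 * e] vertices of [X] lie outside [G], so the trivial bound [3 * m] per term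
   suffices. *)
have sumB : \sum_(x in X :\: G) \sum_(x' in X) #|N x x' :\: C w0| <=
    12 * (m * m * e).
  apply: leq_trans (_ : \sum_(x in X :\: G) \sum_(x' in X) 3 * m <= _).
    by apply: leq_sum => x _; apply: leq_sum => x' _; rewrite -(sysV H) max_card.
  rewrite !sum_nat_const.
  have : #|X :\: G| * (#|X| * (3 * m)) <= (2 * e) * ((2 * m) * (3 * m)).
    by rewrite !leq_mul.
  lia.
apply: leq_trans (_ : \sum_(x in X) \sum_(x' in X)
  (2 * e + #|N x x' :\: C w0| + (x' == x) * (2 * m)) <= _).
  by apply: leq_sum => x Xx; apply: leq_sum => x' Xx'; exact: miss_le.
have diag x : x \in X -> \sum_(x' in X) (x' == x) * (2 * m) = 2 * m.
  move=> Xx; rewrite (bigD1 x) //= eqxx mul1n big1 ?addn0 // => x'.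
  by case/andP => _ /negbTE->.
under eq_bigr => x Xx do rewrite 2!big_split /= sum_nat_const diag //.
rewrite 2!big_split /= !sum_nat_const.
rewrite (big_setID G) /= (setIidPr sGX).
have : #|X| * (#|X| * (2 * e)) <= (2 * m) * ((2 * m) * (2 * e)).
  by rewrite leq_mul // leq_mul2r X2m orbT.
have : #|X| * (2 * m) <= (2 * m) * (2 * m) by rewrite leq_mul2r X2m orbT.
have : m * m <= m * m * e by rewrite leq_pmulr.
move: sumG sumB; move: (\sum_(x in G) _) (\sum_(x in X :\: G) _) => a b.
lia.
Qed.

(** * Missed triples and the rotation from [X], [C] to [C], [Q] *)

Definition miss_at (X : {set V}) c :=
  \sum_(x in X) \sum_(x' in X) ~~ E x x' c.

Lemma card_DN x y (A : {set V}) : #|A :\: N x y| = \sum_(z in A) ~~ E x y z.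
Proof.
rewrite -sum1_card big_mkcond [RHS]big_mkcond; apply: eq_bigr => z _.
by rewrite !inE andbC; case: (z \in A); case: (E x y z).
Qed.

Lemma missE (X C : {set V}) : miss X C = \sum_(c in C) miss_at X c.
Proof.
rewrite exchange_big; apply: eq_bigr => x _.
rewrite exchange_big; apply: eq_bigr => x' _; exact: card_DN.
Qed.

(* For an edge [cc'c''] and any [x], [x'], one of the three vertices is missing
   from [N x x']. *)
Lemma edges_inside_third (X C : {set V}) :
  (\sum_(c in C) \sum_(c' in C) #|N c c' :&: C|) * (#|X| * #|X|) <=
  3 * (#|C| * #|C|) * miss X C.
Proof.
apply: leq_trans (_ : \sum_(c in C) \sum_(c' in C) \sum_(c'' in C)
  (miss_at X c + miss_at X c' + miss_at X c'') <= _); last first.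
  have /= sumM := missE X C.
  rewrite (eq_bigr (fun c => #|C| * (#|C| * miss_at X c) + 2 * #|C| * miss X C)).
    by rewrite big_split /= sum_nat_const -2!big_distrr /= -sumM; lia.
  move=> c _; rewrite (eq_bigr (fun c' => #|C| * miss_at X c +
    #|C| * miss_at X c' + miss X C)) => [|c' _].
    by rewrite 2!big_split /= -!big_distrr /= -sumM !sum_nat_const; lia.
  by rewrite 2!big_split /= -sumM !sum_nat_const.
rewrite big_distrl leq_sum //= => c _; rewrite big_distrl leq_sum //= => c' _.
rewrite card_NI big_distrl leq_sum //= => c'' _.
case Eccc: (E c c' c''); rewrite ?mul0n // mul1n.
rewrite -sum_nat_const /miss_at -2!big_split leq_sum //= => x _.
rewrite -[#|X|]sum1_card -2!big_split leq_sum //= => x' _.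
case Ec: (E x x' c) => //; case Ec': (E x x' c') => //; case Ec'': (E x x' c'') => //.
by have := sysF H Ec Ec' Ec'' Eccc.
Qed.

(* For an edge [xcc'], if [x'] and [x''] lie in [N x c] then [x'x''c'] is missed. *)
Lemma edges_into_first (X C : {set V}) :
  (\sum_(c in C) \sum_(c' in C) #|N c c' :&: X|) * (#|X| * #|X|) <=
  3 * (#|C| * #|X|) * miss X C.
Proof.
pose r x c : nat := \sum_(x' in X) ~~ E x x' c.
have sum_r c : \sum_(x in X) r x c = miss_at X c by [].
apply: leq_trans (_ : \sum_(c in C) \sum_(c' in C) \sum_(x in X)
  (2 * (#|X| * r x c) + miss_at X c') <= _); last first.
  have /= sumM := missE X C.
  rewrite (eq_bigr (fun c => 2 * #|C| * #|X| * miss_at X c + #|X| * miss X C)).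
    by rewrite big_split /= sum_nat_const -big_distrr /= -sumM; lia.
  move=> c _; rewrite (eq_bigr (fun c' => 2 * (#|X| * miss_at X c) +
    #|X| * miss_at X c')) => [|c' _].
    by rewrite big_split /= -!big_distrr /= -sumM !sum_nat_const; lia.
  by rewrite big_split /= -2!big_distrr /= sum_r !sum_nat_const.
rewrite big_distrl leq_sum //= => c _; rewrite big_distrl leq_sum //= => c' _.
rewrite card_NI big_distrl leq_sum //= => x _.
case Eccx: (E c c' x); rewrite ?mul0n // mul1n.
have -> : 2 * (#|X| * r x c) = \sum_(x' in X) \sum_(x'' in X)
    (~~ E x x' c + ~~ E x x'' c).
  under eq_bigr => x' _ do rewrite big_split /= sum_nat_const.
  by rewrite big_split /= -big_distrr /= sum_nat_const; rewrite /r; lia.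
rewrite -sum_nat_const /miss_at -big_split leq_sum //= => x' _.
rewrite -[#|X|]sum1_card -big_split leq_sum //= => x'' _.
case E1: (E x x' c) => //; case E2: (E x x'' c) => //; case E3: (E x' x'' c') => //.
rewrite -Erot in Eccx; rewrite (sysC23 H) in E1; rewrite (sysC23 H) in E2.
by have := sysF H E1 E2 Eccx E3.
Qed.

(** By the two preceding counts, [N c c'] rarely meets [C] or [X]; having at least [m] elements, it
    must fill [Q] up to [g] and these exceptions. The diagonal contributes [#|C| * #|Q|]. The ratio
    9/8 turns the factor 3 of both counts into at most 4. *)
Lemma miss_rotate (X C Q : {set V}) g : X :|: C :|: Q = setT -> 0 < #|X| ->
    8 * #|C| <= 9 * #|X| -> #|Q| <= m + g ->
  miss C Q <= #|C| * #|Q| + #|C| * #|C| * g + 8 * miss X C.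
Proof.
move=> cover X0 CX leQ.
set TC := \sum_(c in C) \sum_(c' in C) #|N c c' :&: C|.
set TX := \sum_(c in C) \sum_(c' in C) #|N c c' :&: X|.
have leTC : TC <= 4 * miss X C.
  have := edges_inside_third X C; rewrite -/TC => le3.
  rewrite -(@leq_pmul2r (#|X| * #|X|)) ?muln_gt0 ?X0 //.
  have : 3 * (#|C| * #|C|) <= 4 * (#|X| * #|X|) by nia.
  move/(leq_mul (leqnn (miss X C))); lia.
have leTX : TX <= 4 * miss X C.
  have := edges_into_first X C; rewrite -/TX => le3.
  rewrite -(@leq_pmul2r (#|X| * #|X|)) ?muln_gt0 ?X0 //.
  have : 3 * (#|C| * #|X|) <= 4 * (#|X| * #|X|) by nia.
  move/(leq_mul (leqnn (miss X C))); lia.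
have ptw c c' : c \in C -> c' \in C -> #|Q :\: N c c'| <=
    g + #|N c c' :&: C| + #|N c c' :&: X| + (c' == c) * #|Q|.
  move=> Cc Cc'; have [-> | ne] := eqVneq c' c.
    by rewrite mul1n; apply: leq_trans (leq_addl _ _); exact/subset_leq_card/subsetDl.
  rewrite addn0; have := sysdeg H ne; rewrite -/(N c' c) (NC c').
  have := cardsID Q (N c c'); have := cardsID (N c c') Q; rewrite (setIC Q).
  have : #|N c c' :\: Q| <= #|N c c' :&: C| + #|N c c' :&: X|.
    apply: leq_trans (leq_card_setU _ _).1; apply/subset_leq_card/subsetP => z.
    rewrite in_setU in_setD !in_setI => /andP[Qz ->] /=.
    by have := in_setT z; rewrite -cover !in_setU (negbTE Qz) orbF orbC.
  lia.
apply: leq_trans (_ : \sum_(c in C) \sum_(c' in C)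
  (g + #|N c c' :&: C| + #|N c c' :&: X| + (c' == c) * #|Q|) <= _).
  by apply: leq_sum => c Cc; apply: leq_sum => c' Cc'; exact: ptw.
have diag c : c \in C -> \sum_(c' in C) (c' == c) * #|Q| = #|Q|.
  move=> Cc; rewrite (bigD1 c) //= eqxx mul1n big1 ?addn0 // => c'.
  by case/andP => _ /negbTE->.
under eq_bigr => c Cc do rewrite 3!big_split /= sum_nat_const diag //.
rewrite 3!big_split /= !sum_nat_const -/TC -/TX; lia.
Qed.

(** * The exact cyclic partition *)

(** All ordered pairs of [D], diagonal included, are non-edges of [h], so 16 times the square of
    [#|D|] is at most [b * b]. *)
Lemma card_independent_le (T : finType) (h : rel T) (A D : {set T}) b :
  D \subset A -> {in D &, forall x y, ~~ h x y} ->
  16 * (\sum_(x in A) \sum_(y in A) ~~ h x y) <= b * b -> 4 * #|D| <= b.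
Proof.
move=> sDA indD leh; rewrite -leq_sqr -!mulnn; apply: leq_trans leh.
suff : #|D| * #|D| <= \sum_(x in A) \sum_(y in A) ~~ h x y by lia.
rewrite [leqRHS](big_setID D) /= (setIidPr sDA); apply: leq_trans (leq_addr _ _).
rewrite -sum_nat_const; apply: leq_sum => x Dx.
rewrite [leqRHS](big_setID D) /= (setIidPr sDA); apply: leq_trans (leq_addr _ _).
by rewrite -sum1_card; apply: leq_sum => y Dy; rewrite indD.
Qed.

(* If [aa'c] is an edge then [c] lies in no triangle of the graph of pairs [cc']
   with [N c c' = A], and [N a a' :&: B] contains no pair [bb'] with
   [N b b' = C].  The first leaves few choices of [c], so [N a a' :&: B] is almost
   all of [B], against the second. *)
Lemma complete_pairs (A B C : {set V}) :
    0 < m -> A :|: B :|: C = setT -> #|B| = m -> #|C| = m ->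
    {in A &, forall a a', [disjoint N a a' & A]} ->
    16 * (\sum_(b in B) \sum_(b' in B) (N b b' != C)) <= m * m ->
    16 * (\sum_(c in C) \sum_(c' in C) (N c c' != A)) <= m * m ->
  {in A &, forall a a', a != a' -> N a a' = B}.
Proof.
move=> m0 cover cardB cardC disA denseB denseC a a' Aa Aa' ne.
pose nbr c := [set c' in C | N c c' == A].
pose bad := [set c in C | [forall c' in nbr c, forall c'' in nbr c, N c' c'' != A]].
(* For [c] in [bad] the set [nbr c] is independent, hence of size at most [m / 4]; so [c] has at
   least [3 * m / 4] non-neighbours, out of at most [m * m / 16] in total. *)
have card_bad : 12 * #|bad| <= m.
  have deg c : c \in bad -> 4 * #|nbr c| <= m.
    rewrite inE => /andP[_ /forall_inP free_c].
    apply: (@card_independent_le _ (fun c' c'' => N c' c'' == A) C) => //.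
      by apply/subsetP => c'; rewrite inE => /andP[].
    by move=> c' c'' nc' nc''; have /forall_inP := free_c _ nc'; apply.
  rewrite -(leq_pmul2r m0); apply: leq_trans denseC.
  suff : \sum_(c in bad) 3 * m <=
      4 * \sum_(c in C) \sum_(c' in C) (N c c' != A).
    rewrite sum_nat_const; lia.
  have sbC : bad \subset C by apply/subsetP => c; rewrite inE => /andP[].
  rewrite big_distrr [leqRHS](big_setID bad) /= (setIidPr sbC).
  apply: leq_trans (leq_addr _ _); apply: leq_sum => c bad_c.
  have := deg _ bad_c.
  suff : #|C :\: nbr c| <= \sum_(c' in C) (N c c' != A).
    have := cardsID (nbr c) C; have := subset_leq_card (subsetIr C (nbr c)); lia.
  rewrite -sum1_card big_mkcond [leqRHS]big_mkcond; apply: leq_sum => c' _.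
  by rewrite !inE; case: (c' \in C); rewrite ?andbF // andbT; case: (_ == _).
have NC_bad : N a a' :&: C \subset bad.
  apply/subsetP => c; rewrite in_setI inE => /andP[Eaac Cc]; rewrite inE Cc /=.
  apply/forall_inP => c'; rewrite inE => /andP[Cc' /eqP Ncc'].
  apply/forall_inP => c''; rewrite inE => /andP[Cc'' /eqP Ncc''].
  apply/eqP => Nc'c''.
  (* The pair [c], [a] would have [c'], [c''] and [a'] in its neighbourhood, with [c'c''a'] an
     edge. *)
  have E1 : E c a c' by rewrite (sysC23 H); move: Aa; rewrite -Ncc' inE.
  have E2 : E c a c'' by rewrite (sysC23 H); move: Aa; rewrite -Ncc'' inE.
  have E3 : E c a a' by rewrite Erot.
  have E4 : E c' c'' a' by move: Aa'; rewrite -Nc'c'' inE.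
  exact: (sysF H E1 E2 E3 E4).
have sNBC : N a a' \subset B :|: C.
  apply/subsetP => z Nz; have := in_setT z; rewrite -cover -setUA in_setU.
  by have /disjointFr -> := disA _ _ Aa Aa'.
have NC0 : N a a' :&: C = set0.
  apply/eqP/set0Pn => -[c /setIP[Nc Cc]].
  have : 4 * #|N a a' :&: B| <= m.
    apply: (@card_independent_le _ (fun b b' => N b b' == C) B) => //.
      exact: subsetIr.
    move=> b b' /setIP[Nb _] /setIP[Nb' _]; apply/eqP => NbbC.
    have Ebb : E b b' c by move: Cc; rewrite -NbbC inE.
    by rewrite (N_indep Nb Nb' Nc) in Ebb.
  have : #|N a a'| <= #|N a a' :&: B| + #|N a a' :&: C|.
    apply: leq_trans (leq_card_setU _ _).1.
    by rewrite -setIUr (setIidPl sNBC).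
  by have := subset_leq_card NC_bad; have := sysdeg H ne; rewrite -/(N a a'); lia.
apply/eqP; rewrite eqEcard cardB; apply/andP; split; last exact: sysdeg H _ _ ne.
apply/subsetP => z Nz; have := subsetP sNBC _ Nz; rewrite in_setU.
by case/orP => // Cz; have := in_set0 z; rewrite -NC0 in_setI Nz Cz.
Qed.

Lemma N_disjoint x y x' y' : x' \in N x y -> y' \in N x y ->
  [disjoint N x y & N x' y'].
Proof.
move=> Nx' Ny'; rewrite disjoints_subset; apply/subsetP => z Nz.
by rewrite in_setC inE (N_indep Nx' Ny' Nz).
Qed.

Lemma cyclic_partition A B C a a' b b' c c' :
    A = N c c' -> B = N a a' -> C = N b b' ->
    a \in A -> a' \in A -> b \in B -> b' \in B -> c \in C -> c' \in C ->
  [/\ A :|: B :|: C = setT, [/\ [disjoint A & B], [disjoint B & C] & [disjoint C & A]] &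
   [/\ #|A| = m, #|B| = m & #|C| = m]].
Proof.
move=> defA defB defC Aa Aa' Bb Bb' Cc Cc'.
have dAB : [disjoint A & B] by rewrite defA defB; apply: N_disjoint; rewrite -defA.
have dBC : [disjoint B & C] by rewrite defB defC; apply: N_disjoint; rewrite -defB.
have dCA : [disjoint C & A] by rewrite defA defC; apply: N_disjoint; rewrite -defC.
have ltm x y z : z \in N x y -> m <= #|N x y|.
  by rewrite inE => /E_neq[ne _ _]; exact: sysdeg H _ _ ne.
have leA : m <= #|A| by move: Aa; rewrite defA; exact: ltm.
have leB : m <= #|B| by move: Bb; rewrite defB; exact: ltm.
have leC : m <= #|C| by move: Cc; rewrite defC; exact: ltm.
have cardU : #|A :|: B :|: C| = #|A| + #|B| + #|C|.
  rewrite cardsU (cardsU A) setIUl.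
  move: dAB dBC dCA; rewrite -!setI_eq0 => /eqP-> /eqP-> /eqP dCA.
  by rewrite (setIC A) dCA setU0 !cards0 !subn0.
have := max_card (A :|: B :|: C); rewrite cardU (sysV H) => leU.
split; [|by split|by move: leA leB leC leU; clear; split; lia].
move: leA leB leC => *; apply/eqP; rewrite eqEcard subsetT cardsT cardU (sysV H) /=; lia.
Qed.

(** At most [2 * (#|B| * #|B :\: B0|)] ordered pairs of [B] have a member outside [B0]. *)
Lemma miss_at_near (B B0 : {set V}) c :
  miss_at B c <= miss_at B0 c + 2 * (#|B| * #|B :\: B0|).
Proof.
have cardD : #|B :\: B0| = \sum_(b in B) (b \notin B0).
  rewrite -sum1_card big_mkcond [RHS]big_mkcond; apply: eq_bigr => b _.
  by rewrite !inE andbC; case: (b \in B); case: (b \in B0).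
apply: leq_trans (_ : \sum_(b in B) \sum_(b' in B)
  ([&& b \in B0, b' \in B0 & ~~ E b b' c] + (b \notin B0) + (b' \notin B0)) <= _).
  apply: leq_sum => b _; apply: leq_sum => b' _.
  by case: (b \in B0); case: (b' \in B0); case: (E b b' c).
rewrite (eq_bigr (fun b => \sum_(b' in B) [&& b \in B0, b' \in B0 & ~~ E b b' c] +
    #|B| * (b \notin B0) + #|B :\: B0|)) => [|b _]; last first.
  by rewrite 2!big_split /= sum_nat_const cardD.
rewrite 2!big_split /= -big_distrr /= -cardD sum_nat_const.
rewrite [leqRHS](_ : _ = miss_at B0 c + #|B| * #|B :\: B0| + #|B| * #|B :\: B0|);
  last lia.
rewrite !leq_add2r /miss_at big_mkcond [leqRHS]big_mkcond; apply: leq_sum => b _.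
case: (b \in B0); last by case: ifP => // _; rewrite big1.
apply: leq_trans (_ : \sum_(b' in B) ((b' \in B0) && ~~ E b b' c) <= _).
  by case: ifP.
rewrite big_mkcond [leqRHS]big_mkcond; apply: leq_sum => b' _.
by case: (b' \in B); case: (b' \in B0).
Qed.

(** If [bb'c] and [bb'c'] are both edges, then [N b b'] is disjoint from [A = N c c'], and from
    [B = N a a'] by independence; so it lies in [C], and equals it by size. Hence every exceptional
    pair is missed at [c] or at [c']. *)
Lemma dense_pairs (A B C B0 : {set V}) a a' c c' :
    A :|: B :|: C = setT -> B = N a a' -> A = N c c' -> #|B| = m -> #|C| = m ->
    64 * 64 * miss_at B0 c <= m * m -> 64 * 64 * miss_at B0 c' <= m * m ->
    128 * #|B :\: B0| <= m ->
  16 * (\sum_(b in B) \sum_(b' in B) (N b b' != C)) <= m * m.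
Proof.
move=> cover defB defA cardB cardC leMc leMc' leD.
suff : \sum_(b in B) \sum_(b' in B) (N b b' != C) <= miss_at B c + miss_at B c'.
  have := miss_at_near B B0 c; have := miss_at_near B B0 c'; rewrite cardB.
  have : 128 * (m * #|B :\: B0|) <= m * m by rewrite mulnCA leq_mul2l leD orbT.
  lia.
rewrite -big_split; apply: leq_sum => b Bb; rewrite -big_split.
apply: leq_sum => b' Bb' /=.
case Ec: (E b b' c) => //=; last by case: eqP.
case Ec': (E b b' c') => //=; last by case: eqP.
suff -> : N b b' = C by rewrite eqxx.
have sNC : N b b' \subset C.
  apply/subsetP => z Nz; have := in_setT z; rewrite -cover !in_setU.
  have dA : [disjoint N b b' & A] by rewrite defA; apply: N_disjoint; rewrite inE.
  rewrite (disjointFr dA Nz) /=; case Bz: (z \in B) => //.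
  move: Bz Bb Bb'; rewrite defB => Bz Bb Bb'.
  by have := N_indep Bb Bb' Bz; move: Nz; rewrite inE => ->.
apply/eqP; rewrite eqEcard sNC cardC; have [ne _ _] := E_neq Ec.
exact: sysdeg H _ _ ne.
Qed.

Lemma exists_pair_le (S : {set V}) (F : V -> V -> nat) b : 0 < #|S| ->
  \sum_(x in S) \sum_(x' in S) F x x' <= #|S| * #|S| * b ->
  exists x x', [/\ x \in S, x' \in S & F x x' <= b].
Proof.
move=> S0; rewrite -mulnA => /(exists_le_mean S0)[x Sx].
by case/(exists_le_mean S0) => x' Sx' le; exists x, x'.
Qed.

Definition typical (X C : {set V}) := [set c in C | 64 * 64 * miss_at X c <= m * m].

Lemma card_typical (X C : {set V}) : 0 < m ->
  8 * (64 * 64 * miss X C) <= m * (m * m) -> 8 * #|C :\: typical X C| <= m.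
Proof.
move=> m0 leM; rewrite -(@leq_pmul2r (m * m)) ?muln_gt0 ?m0 //.
apply: leq_trans leM.
rewrite -mulnA leq_mul2l missE big_distrr [leqRHS](big_setID (typical X C)) /=.
apply: leq_trans (leq_addl _ _); rewrite -sum_nat_const; apply: leq_sum => c.
by rewrite !inE => /andP[+ Cc]; rewrite Cc -ltnNge => /ltnW.
Qed.

(** This fixes every triple with two vertices in one part, as in [T_edges A B C], and leaves the
    transversal triples open. *)
Record cyclic_system (A B C : {set V}) : Prop := CyclicSystem {
  cyc_cover : A :|: B :|: C = setT;
  cyc_dAB : [disjoint A & B];
  cyc_dBC : [disjoint B & C];
  cyc_dCA : [disjoint C & A];
  cyc_cardA : #|A| = m;
  cyc_cardB : #|B| = m;
  cyc_cardC : #|C| = m;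
  cyc_NA : {in A &, forall a a', a != a' -> N a a' = B};
  cyc_NB : {in B &, forall b b', b != b' -> N b b' = C};
  cyc_NC : {in C &, forall c c', c != c' -> N c c' = A}
}.

Lemma N_self_disjoint x y : {in N x y &, forall u v, [disjoint N u v & N x y]}.
Proof.
move=> u v Nu Nv; rewrite disjoint_sym disjoints_subset; apply/subsetP => z Nz.
by rewrite in_setC inE (N_indep Nu Nv Nz).
Qed.

(* [A0], [B0], [C0] almost carry the cyclic structure; two typical vertices in
   each of them give neighbourhoods that carry it exactly. *)
Lemma exists_cyclic_system (A0 B0 C0 : {set V}) : 0 < m ->
    256 * m <= 256 * #|A0| + m -> 256 * m <= 256 * #|B0| + m ->
    256 * m <= 256 * #|C0| + m ->
    8 * (64 * 64 * miss A0 B0) <= m * (m * m) ->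
    8 * (64 * 64 * miss B0 C0) <= m * (m * m) ->
    8 * (64 * 64 * miss C0 A0) <= m * (m * m) ->
  exists A B C, cyclic_system A B C.
Proof.
move=> m0 sA sB sC mAB mBC mCA.
have gA := card_typical m0 mCA; have gB := card_typical m0 mAB.
have gC := card_typical m0 mBC.
have sub_typ X D : typical X D \subset D.
  by apply/subsetP => c; rewrite inE => /andP[].
(* There are at least [m * m / 4] ordered pairs, so the mean of [F] is at most [m / 256]. *)
have bound (S D : {set V}) (F : V -> V -> nat) : S \subset D -> m <= 2 * #|S| ->
    1024 * (\sum_(x in S) \sum_(x' in S) F x x') <= m * (m * m) ->
    exists x x', [/\ x \in S, x' \in S & 256 * F x x' <= m].
  move=> sSD leS leF; apply: (@exists_pair_le S (fun x x' => 256 * F x x')).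
    by move: m0 leS; clear; lia.
  under eq_bigr do rewrite -big_distrr; rewrite -big_distrr /=.
  have := leq_mul leS leS; move/(leq_mul (leqnn m)).
  by move: leF; clear; lia.
have sum_sub (S D : {set V}) (F : V -> V -> nat) : S \subset D ->
    \sum_(x in S) \sum_(x' in S) F x x' <= \sum_(x in D) \sum_(x' in D) F x x'.
  move=> sSD; rewrite [leqRHS](big_setID S) /= (setIidPr sSD).
  apply: leq_trans (leq_addr _ _); apply: leq_sum => x _.
  by rewrite [leqRHS](big_setID S) /= (setIidPr sSD) leq_addr.
have [a [a' [Aa Aa' le_aa]]] : exists a a', [/\ a \in typical C0 A0,
    a' \in typical C0 A0 & 256 * #|B0 :\: N a a'| <= m].
  apply: (bound _ A0); first exact: sub_typ.
    have := cardsID (typical C0 A0) A0; rewrite (setIidPr (sub_typ _ _)).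
    by move: gA sA; clear; lia.
  have := sum_sub _ _ (fun a a' => #|B0 :\: N a a'|) (sub_typ C0 A0).
  rewrite -/(miss A0 B0); move: mAB; clear.
  by move: (miss _ _) (\sum_(a in _) _) => k l; lia.
pose B := N a a'; pose SB := typical A0 B0 :&: B.
have cardI (D D' E' : {set V}) : D' \subset D ->
    #|D| <= #|D' :&: E'| + #|D :\: D'| + #|D :\: E'|.
  move=> sD; have := cardsID E' D'; have := cardsID D' D; rewrite (setIidPr sD).
  by have := subset_leq_card (setSD E' sD); clear; lia.
have [b [b' [SBb SBb' le_bb]]] : exists b b', [/\ b \in SB, b' \in SB &
    256 * #|C0 :\: N b b'| <= m].
  have sSB : SB \subset B0 by rewrite subIset // sub_typ.
  apply: (bound _ B0) => //.
    have := cardI _ _ B (sub_typ A0 B0); rewrite -/SB.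
    by move: gB sB le_aa; rewrite -/B; clear; lia.
  have := sum_sub _ _ (fun b b' => #|C0 :\: N b b'|) sSB.
  rewrite -/(miss B0 C0); move: mBC; clear.
  by move: (miss _ _) (\sum_(b in _) _) => k l; lia.
pose C := N b b'; pose SC := typical B0 C0 :&: C.
(* A single penalty of weight [m] would break the bound, so [cc'a] and [cc'a'] are edges: [a] and
   [a'] lie in [N c c'], which closes the cycle. Typicality of [a] and [a'] keeps the mean penalty
   small. *)
have [c [c' [SCc SCc' le_cc]]] : exists c c', [/\ c \in SC, c' \in SC &
    256 * (#|A0 :\: N c c'| + m * ~~ E c c' a + m * ~~ E c c' a') <= m].
  have sSC : SC \subset C0 by rewrite subIset // sub_typ.
  apply: (bound _ C0) => //.
    have := cardI _ _ C (sub_typ B0 C0); rewrite -/SC.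
    by move: gC sC le_bb; rewrite -/C; clear; lia.
  apply: leq_trans (_ : 1024 * (miss C0 A0 + m * miss_at C0 a + m * miss_at C0 a') <= _).
    rewrite leq_mul2l; apply: leq_trans (sum_sub _ _ _ sSC) _.
    rewrite (eq_bigr (fun c => \sum_(c' in C0) #|A0 :\: N c c'| +
      m * \sum_(c' in C0) ~~ E c c' a + m * \sum_(c' in C0) ~~ E c c' a')) => [|c _].
      by rewrite 2!big_split /= -2!big_distrr.
    by rewrite 2!big_split /= -2!big_distrr.
  move: Aa Aa'; rewrite !inE => /andP[_ /(leq_mul (leqnn m)) le1].
  case/andP => _ /(leq_mul (leqnn m)) le2.
  by move: le1 le2 mCA; clear; lia.
pose A := N c c'.
have Ecca : E c c' a by move: le_cc; case: (E c c' a) => //=; move: m0; clear; lia.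
have Ecca' : E c c' a' by move: le_cc; case: (E c c' a') => //=; move: m0; clear; lia.
have {}le_cc : 256 * #|A0 :\: A| <= m by move: le_cc; rewrite -/A; clear; lia.
have [AA AA'] : a \in A /\ a' \in A by rewrite !inE.
have [[Tb Bb] [Tb' Bb']] := (setIP SBb, setIP SBb').
have [[Tc Cc] [Tc' Cc']] := (setIP SCc, setIP SCc').
have typE X D z : z \in typical X D -> 64 * 64 * miss_at X z <= m * m.
  by rewrite inE => /andP[].
have [cover [dAB dBC dCA] [cardA cardB cardC]] :=
  cyclic_partition (erefl A) (erefl B) (erefl C) AA AA' Bb Bb' Cc Cc'.
have near (D D0 : {set V}) : #|D| = m -> 256 * m <= 256 * #|D0| + m ->
    256 * #|D0 :\: D| <= m -> 128 * #|D :\: D0| <= m.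
  have := cardsID D D0; have := cardsID D0 D; rewrite setIC; clear; lia.
have cover' : C :|: A :|: B = setT by rewrite -setUA setUC.
have cover'' : B :|: C :|: A = setT by rewrite setUC setUA.
have dense_A := dense_pairs cover' (erefl A) (erefl C) cardA cardB
  (typE _ _ _ Tb) (typE _ _ _ Tb') (near _ _ cardA sA le_cc).
have dense_B := dense_pairs cover (erefl B) (erefl A) cardB cardC
  (typE _ _ _ Tc) (typE _ _ _ Tc') (near _ _ cardB sB le_aa).
have dense_C := dense_pairs cover'' (erefl C) (erefl B) cardC cardA
  (typE _ _ _ Aa) (typE _ _ _ Aa') (near _ _ cardC sC le_bb).
exists A, B, C; split=> //.
- exact: (complete_pairs m0 cover cardB cardC (@N_self_disjoint _ _) dense_B dense_C).
- exact: (complete_pairs m0 cover'' cardC cardA (@N_self_disjoint _ _) dense_C dense_A).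
- exact: (complete_pairs m0 cover' cardA cardB (@N_self_disjoint _ _) dense_A dense_B).
Qed.

(** The constants: [e] is about [m / k]; [d' = 12 * k] leaves at most [2 * e] vertices of [X] that
    are not good; [d = 72 * (k * k)] makes [d' * (3 * m) <= d * e], so [rich] sets have at least
    [m - 2 * e] elements. *)
Lemma cyclic_system_of_large k : 0 < k -> 8 * (64 * 64) * 3000 <= k ->
    4 * k <= m -> (72 * (k * k)) ^ (4 * k) < 3 * m ->
  exists A B C, cyclic_system A B C.
Proof.
move=> k0 kbig mk m_big; pose d := 72 * (k * k); pose d' := 12 * k; pose e := m %/ k.
have m0 : 0 < m by lia.
have e0 : 0 < e by rewrite divn_gt0 //; lia.
have ke : k * e <= m by rewrite mulnC leq_trunc_div.
have mke : m < k * e + k by rewrite addnC -mulnS mulnC ltn_ceil.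
have d1 : 1 < d by rewrite /d; nia.
have [S [S0 leS stS]] := exists_stable_set m0 e0 d1.
(* For [#|S| = 1] the bound [leS] reads [(3 * m) ^ e <= d ^ (3 * m)]; since [3 * m <= 4 * k * e],
   this gives [3 * m <= d ^ (4 * k)]. *)
have S1 : 1 < #|S|.
  rewrite ltnNge; apply/negP => S1; move: m_big; rewrite ltnNge => /negP; apply.
  rewrite -/d -(leq_exp2r _ _ e0) -(sysV H); apply: leq_trans leS _.
  have -> : #|S| = 1 by lia.
  rewrite exp1n mul1n -expnM leq_pexp2l ?(sysV H) //; first by lia.
  by move: mke mk ke; clear; lia.
have led : 0 < d' <= d by rewrite /d /d'; nia.
have [s [s' [Ss Ss' ne bad_small]]] := exists_good_pair led S1.
pose X := N s s'; pose G := [set w in X | good d d' S w].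
have sGX : G \subset X by apply/subsetP => w; rewrite inE => /andP[].
have XG : X :\: G = [set w in N s s' | ~~ good d d' S w].
  by apply/setP => w; rewrite !inE; case: (E s s' w); rewrite ?andbT ?andbF.
have leX : m <= #|X| by exact: sysdeg H _ _ ne.
have em : 3 * e < m by nia.
have ke' : m <= 2 * (k * e) by move: mke mk ke; clear; lia.
have badX : #|X :\: G| <= 2 * e.
  have d'E : d' = 12 * k by [].
  rewrite XG; move: bad_small; rewrite d'E (sysV H) => bad_small.
  rewrite -(leq_pmul2l k0); move: bad_small ke'; clear; lia.
have disX : {in X &, forall x x', [disjoint N x x' & X]} by exact: N_self_disjoint.
have ZX : [disjoint X & Z S] by exact: N_disjoint_Z.
have propG : {in G, forall w, [/\ [disjoint rich d S w & X],
    m <= #|rich d S w| + 2 * e &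
    \sum_(x in X) #|N w x :&: rich d S w| <= 2 * m * e]}.
  move=> w; rewrite inE => /andP[Xw gw].
  have dR : [disjoint rich d S w & X].
    rewrite disjoint_sym; apply: disjointWr ZX.
    by apply/subsetP => u; rewrite inE => /andP[].
  split=> //.
    have d0 : 0 < d by lia.
    rewrite -(leq_pmul2l d0); have := card_rich d0 S0 stS gw.
    have : d' * (3 * m) <= d * e.
      rewrite /d /d'; have := leq_mul (leqnn k) ke'; move: (k * _) => x; nia.
    lia.
  (* Counted from [u] in [rich d S w]: [N u w :&: X] lies outside [Z S], so stability bounds it by
     [e]. *)
  rewrite sum_card_NI.
  apply: leq_trans (_ : \sum_(u in rich d S w) e <= _).
    apply: leq_sum => u; rewrite inE => /andP[_ /stS]; apply: leq_trans.
    apply/subset_leq_card/subsetP => z /setIP[Nz Xz].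
    by rewrite in_setD Nz (disjointFr ZX Xz).
  rewrite sum_nat_const leq_mul2r; apply/orP; right.
  have := max_card (X :|: rich d S w); rewrite (sysV H) cardsU.
  by move: dR; rewrite disjoint_sym -setI_eq0 => /eqP->; rewrite cards0; lia.
have [C [Q [cover [cardXCQ leC leQ leM]]]] :=
  near_partition e0 em leX sGX badX disX propG.
have ke768 : 768 * e <= m by apply: leq_trans ke; rewrite leq_mul2r; move: kbig; clear; lia.
have C2m : #|C| <= 2 * m by move: cardXCQ leX leQ ke768; clear; lia.
have Q2m : #|Q| <= 2 * m by move: cardXCQ leX leC ke768; clear; lia.
have X2m : #|X| <= 2 * m by move: cardXCQ leC leQ ke768; clear; lia.
set P := m * m * e in leM.
have mmP : m * m <= P by rewrite leq_pmulr.
have mulP (x y : nat) : x <= 2 * m -> y <= 2 * m -> x * y <= 4 * (m * m).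
  by move=> lex ley; have := leq_mul lex ley; clear; lia.
have P_small : 8 * (64 * 64 * (3000 * P)) <= m * (m * m).
  have := leq_mul (leqnn (m * m)) ke.
  have := leq_mul (leqnn P) kbig; rewrite /P; clear; lia.
(* Two rotations, in units of [P]: [4 + 12 + 8 * 44 = 368], then [4 + 24 + 8 * 368 <= 3000]. *)
have leM2 : miss C Q <= 368 * P.
  apply: leq_trans (miss_rotate (g := 3 * e) cover _ _ _) _.
  - by move: leX m0; clear; lia.
  - by move: cardXCQ leX leQ ke768; clear; lia.
  - by move: cardXCQ leX leC; clear; lia.
  have := mulP _ _ C2m Q2m; have := mulP _ _ C2m C2m => /(leq_mul (leqnn e)).
  by move: mmP leM; rewrite /P; clear; lia.
have leM3 : miss Q X <= 3000 * P.
  have cover' : C :|: Q :|: X = setT by rewrite setUC setUA.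
  apply: leq_trans (miss_rotate (g := 6 * e) cover' _ _ _) _.
  - by move: leC ke768 m0; clear; lia.
  - by move: cardXCQ leX leC ke768; clear; lia.
  - by move: cardXCQ leQ leC; clear; lia.
  have := mulP _ _ Q2m X2m; have := mulP _ _ Q2m Q2m => /(leq_mul (leqnn e)).
  by move: mmP leM2; rewrite /P; clear; lia.
apply: (@exists_cyclic_system Q X C) => //.
- by move: leQ ke768; clear; lia.
- by move: leX; clear; lia.
- by move: leC ke768; clear; lia.
- by move: leM3 P_small; clear; lia.
- by move: leM P_small; clear; lia.
- by move: leM2 P_small; clear; lia.
Qed.

End System.

(** * Comparison with the members of the family *)

Definition cyclic_rule (V : finType) (E : V -> V -> V -> bool) (A B : {set V}) :=
  {in A &, forall x y, x != y -> forall z, E x y z = (z \in B)}.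

Lemma cyclic_rule_ext (V : finType) (E E' : V -> V -> V -> bool) (A B C : {set V}) :
    A :|: B :|: C = setT ->
    (forall x y z, E x y z = E y x z) -> (forall x y z, E x y z = E x z y) ->
    (forall x y z, E' x y z = E' y x z) -> (forall x y z, E' x y z = E' x z y) ->
    cyclic_rule E A B -> cyclic_rule E B C -> cyclic_rule E C A ->
    cyclic_rule E' A B -> cyclic_rule E' B C -> cyclic_rule E' C A ->
    {in A & B & C, forall a b c, E a b c = E' a b c} ->
  forall x y z, x != y -> y != z -> x != z -> E x y z = E' x y z.
Proof.
move=> cover s12 s23 s12' s23' rA rB rC rA' rB' rC' abc x y z xy yz xz.
have cls u : [|| u \in A, u \in B | u \in C].
  by have := in_setT u; rewrite -cover !in_setU orbA.
have eqA u v w : u \in A -> v \in A -> u != v -> E u v w = E' u v w.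
  by move=> Au Av uv; rewrite rA ?rA'.
have eqB u v w : u \in B -> v \in B -> u != v -> E u v w = E' u v w.
  by move=> Au Av uv; rewrite rB ?rB'.
have eqC u v w : u \in C -> v \in C -> u != v -> E u v w = E' u v w.
  by move=> Au Av uv; rewrite rC ?rC'.
(* Two vertices in a common part are moved to the front; a transversal triple is put in the order
   [A], [B], [C]. *)
case/or3P: (cls x) => Kx; case/or3P: (cls y) => Ky; case/or3P: (cls z) => Kz;
 first [ exact: eqA | exact: eqB | exact: eqC
 | by rewrite s23 s23'; first [exact: eqA | exact: eqB | exact: eqC | exact: abc]
 | by rewrite s12 s12' s23 s23';
      first [exact: eqA | exact: eqB | exact: eqC | exact: abc]
 | exact: abc | by rewrite s12 s12'; exact: abc
 | by rewrite s23 s23' s12 s12'; exact: abc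
 | by rewrite s12 s12' s23 s23' s12 s12'; exact: abc ].
Qed.

Lemma card_set3I (V : finType) (x y z : V) (A : {set V}) :
  x != y -> y != z -> x != z ->
  #|[set x; y; z] :&: A| = (x \in A) + (y \in A) + (z \in A).
Proof.
move=> xy yz xz.
have -> : #|[set x; y; z] :&: A| = \sum_(u in [set x; y; z]) (u \in A).
  rewrite -sum1_card big_mkcond [RHS]big_mkcond; apply: eq_bigr => u _.
  by rewrite in_setI; case: (_ \in _); case: (_ \in _).
rewrite setUC big_setU1 /=; last by rewrite !inE negb_or eq_sym xz eq_sym.
by rewrite big_setU1 ?inE // big_set1 addnC.
Qed.

Lemma card_set3 (V : finType) (x y z : V) :
  x != y -> y != z -> x != z -> #|[set x; y; z]| = 3.
Proof. by move=> *; rewrite -(setIT [set _; _; _]) card_set3I // !inE. Qed.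

Lemma set3_neq (V : finType) (x y z : V) : #|[set x; y; z]| = 3 ->
  [/\ x != y, y != z & x != z].
Proof.
move=> c3; split; apply/eqP => eq2; move: c3; rewrite eq2.
- by rewrite setUid cards2; case: (_ != _).
- by rewrite -setUA setUid cards2; case: (_ != _).
- by rewrite setUAC setUid cards2; case: (_ != _).
Qed.

Lemma T_edges_rot (V : finType) (A B C : {set V}) : T_edges A B C = T_edges B C A.
Proof. by apply/setP => e; rewrite inE [RHS]inE orbC -orbA. Qed.

Definition triple (V : finType) (F : {set {set V}}) x y z := [set x; y; z] \in F.

Lemma T_edges_rule (V : finType) (A B C : {set V}) :
    A :|: B :|: C = setT ->
    [disjoint A & B] -> [disjoint B & C] -> [disjoint C & A] ->
  cyclic_rule (triple (T_edges A B C)) A B.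
Proof.
move=> cover dAB dBC dCA x y Ax Ay xy z; rewrite /triple inE.
have [Bx By] := (disjointFr dAB Ax, disjointFr dAB Ay).
have [Cx Cy] := (disjointFl dCA Ax, disjointFl dCA Ay).
have [/set3_neq[_ yz xz] | ne3] := eqVneq #|_| 3; last first.
  apply/esym/negbTE; apply: contra ne3 => Bz; rewrite card_set3 //.
    by apply: contraTneq Bz => <-; rewrite By.
  by apply: contraTneq Bz => <-; rewrite Bx.
rewrite !card_set3I // Ax Ay Bx By Cx Cy /=.
have := in_setT z; rewrite -cover !in_setU.
case Az: (z \in A); first by rewrite (disjointFr dAB Az) (disjointFl dCA Az).
case Bz: (z \in B); first by rewrite (disjointFr dBC Bz).
by move=> /= ->.
Qed.

Lemma T_edges_transversal (V : finType) (A B C : {set V}) :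
    [disjoint A & B] -> [disjoint B & C] -> [disjoint C & A] ->
  {in A & B & C, forall a b c, triple (T_edges A B C) a b c = false}.
Proof.
move=> dAB dBC dCA a b c Aa Bb Cc; rewrite /triple inE.
apply/negP => /andP[/eqP/set3_neq[ab bc ac]]; rewrite !card_set3I //.
rewrite Aa Bb Cc (disjointFr dAB Aa) (disjointFl dCA Aa).
rewrite (disjointFl dAB Bb) (disjointFr dBC Bb).
by rewrite (disjointFr dCA Cc) (disjointFl dBC Cc).
Qed.

Section Template.

Variables (m : nat) (phi : 'I_m * 'I_m -> 'I_m).

Lemma in_partA (v : vert m) : v \in partA m = if v is inl (inl _) then true else false.
Proof. by case: v => [[i|i]|i]; apply/imsetP; [exists i | case | case]. Qed.

Lemma in_partB (v : vert m) : v \in partB m = if v is inl (inr _) then true else false.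
Proof. by case: v => [[i|i]|i]; apply/imsetP; [case | exists i | case]. Qed.

Lemma in_partC (v : vert m) : v \in partC m = if v is inr _ then true else false.
Proof. by case: v => [[i|i]|i]; apply/imsetP; [case | case | exists i]. Qed.

Lemma parts_cover : partA m :|: partB m :|: partC m = setT.
Proof.
apply/setP => v; rewrite !in_setU in_partA in_partB in_partC inE.
by case: v => [[]|].
Qed.

Lemma parts_disjoint : [/\ [disjoint partA m & partB m],
  [disjoint partB m & partC m] & [disjoint partC m & partA m]].
Proof.
split; rewrite disjoints_subset; apply/subsetP => v; rewrite in_setC.
- by rewrite in_partA in_partB; case: v => [[]|].
- by rewrite in_partB in_partC; case: v => [[]|].
- by rewrite in_partC in_partA; case: v => [[]|].
Qed.

Lemma TphiE x y z : triple (Tphi_edges phi) x y z =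
  triple (T_edges (partA m) (partB m) (partC m)) x y z ||
  [exists e, [set x; y; z] == [set vA e.1; vB e.2; vC (phi e)]].
Proof.
rewrite /triple inE; congr orb; apply/imsetP/existsP => [[e _ ->] | [e /eqP ->]].
  by exists e.
by exists e.
Qed.

Lemma Tphi_same_part (A : {set vert m}) x y z :
    A \in [:: partA m; partB m; partC m] -> x \in A -> y \in A -> x != y ->
  [exists e, [set x; y; z] == [set vA e.1; vB e.2; vC (phi e)]] = false.
Proof.
move=> partA_ Ax Ay; apply: contraNF => /existsP[e /eqP eq_e].
have : x \in [set x; y; z] by rewrite !inE eqxx.
have : y \in [set x; y; z] by rewrite !inE eqxx orbT.
rewrite eq_e !inE -!orbA.
move: partA_ Ax Ay; rewrite !inE => /or3P[] /eqP->;
  rewrite ?in_partA ?in_partB ?in_partC;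
  by case: x {eq_e} => [[?|?]|?] //; case: y => [[?|?]|?] // _ _;
     move=> /or3P[] /eqP // -> /or3P[] /eqP // ->.
Qed.

Lemma Tphi_rules : [/\ cyclic_rule (triple (Tphi_edges phi)) (partA m) (partB m),
  cyclic_rule (triple (Tphi_edges phi)) (partB m) (partC m) &
  cyclic_rule (triple (Tphi_edges phi)) (partC m) (partA m)].
Proof.
have [dAB dBC dCA] := parts_disjoint.
split=> x y Ax Ay xy z; rewrite TphiE.
- rewrite (Tphi_same_part _ _ Ax Ay xy) ?orbF ?inE ?eqxx ?orbT //.
  exact: T_edges_rule parts_cover _ _ _ _ _ _ _ _ _.
- rewrite (Tphi_same_part _ _ Ax Ay xy) ?orbF ?inE ?eqxx ?orbT //.
  rewrite T_edges_rot; apply: T_edges_rule => //.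
  by rewrite setUC setUA parts_cover.
- rewrite (Tphi_same_part _ _ Ax Ay xy) ?orbF ?inE ?eqxx ?orbT //.
  rewrite -T_edges_rot; apply: T_edges_rule => //.
  by rewrite -setUA setUC parts_cover.
Qed.

Lemma Tphi_transversal i j k :
  triple (Tphi_edges phi) (vA i) (vB j) (vC k) = (k == phi (i, j)).
Proof.
have [dAB dBC dCA] := parts_disjoint.
rewrite TphiE T_edges_transversal ?in_partA ?in_partB ?in_partC //=.
apply/existsP/eqP => [[[i' j'] /eqP/setP eq_e] | ->]; last by exists (i, j).
have : vA i \in [set vA i'; vB j'; vC (phi (i', j'))] by rewrite -eq_e !inE eqxx.
have : vB j \in [set vA i'; vB j'; vC (phi (i', j'))].
  by rewrite -eq_e !inE eqxx orbT.
have : vC k \in [set vA i'; vB j'; vC (phi (i', j'))].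
  by rewrite -eq_e !inE eqxx !orbT.
rewrite !inE -!orbA => /or3P[] /eqP // [->] /or3P[] /eqP // [->].
by case/or3P => /eqP // [->].
Qed.

End Template.

(** * The transversal edges form a proper colouring *)

Section Colouring.

Variables (V : finType) (E : V -> V -> V -> bool) (m : nat).
Hypothesis H : F32_free_system E m.
Variables A B C : {set V}.
Hypothesis cyc : cyclic_system E m A B C.
Hypothesis m_gt1 : 1 < m.

Lemma exists_other (D : {set V}) x : #|D| = m -> exists2 y, y \in D & x != y.
Proof.
move=> cardD; have /set0Pn[y] : D :\ x != set0.
  by rewrite -card_gt0; have := cardsD1 x D; rewrite cardD; case: (x \in D); lia.
by rewrite !inE => /andP[ne Dy]; exists y => //; rewrite eq_sym.
Qed.

Lemma cyclic_rules : [/\ cyclic_rule E A B, cyclic_rule E B C & cyclic_rule E C A].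
Proof.
split=> x y Dx Dy xy z.
- by rewrite -(cyc_NA cyc Dx Dy xy) inE.
- by rewrite -(cyc_NB cyc Dx Dy xy) inE.
- by rewrite -(cyc_NC cyc Dx Dy xy) inE.
Qed.

(** [N E a b] avoids [B], and [A :\ a] has only [m - 1] elements, so a colour exists. With two
    colours [c], [c'] and another [a'] in [A], the edge [cc'a'] would lie inside [N E a b]. *)
Lemma exists_colour a b : a \in A -> b \in B ->
  exists2 c, c \in C & {in C, forall c', E a b c' = (c' == c)}.
Proof.
move=> Aa Bb; have [rA rB rC] := cyclic_rules.
have ab : a != b by apply: contraTneq Bb => <-; rewrite (disjointFr (cyc_dAB cyc) Aa).
have sN : N E a b \subset (A :\ a) :|: (N E a b :&: C).
  apply/subsetP => z Nz; have Eabz : E a b z by move: Nz; rewrite inE.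
  have [_ bz az] := E_neq H Eabz.
  have := in_setT z; rewrite -(cyc_cover cyc) !in_setU in_setD1 in_setI Nz.
  case/orP => [/orP[-> | Bz] | ->]; rewrite ?orbT //; first by rewrite eq_sym az.
  move: Eabz; rewrite (Erot H) (rB _ _ Bb Bz bz).
  by rewrite (disjointFl (cyc_dCA cyc) Aa).
have /set0Pn[c /setIP[Nc Cc]] : N E a b :&: C != set0.
  rewrite -card_gt0; have := subset_leq_card sN; have := sysdeg H ab.
  rewrite -/(N E a b); have := (leq_card_setU (A :\ a) (N E a b :&: C)).1.
  by have := cardsD1 a A; rewrite Aa (cyc_cardA cyc); lia.
exists c => // c' Cc'; have [-> | ne] := eqVneq; first by move: Nc; rewrite inE.
apply/negbTE/negP => Eabc'.
have [a' Aa' aa'] := exists_other a (cyc_cardA cyc).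
have Na' : a' \in N E a b by rewrite inE (sysC23 H) rA.
have Nc' : c' \in N E a b by rewrite inE.
by have := N_indep H Nc' Nc Na'; rewrite rC // Aa'.
Qed.

(** Otherwise, for another [c'] in [C], the edge [bb'c'] lies inside [N E a c]. *)
Lemma colour_inj_r a b b' c : a \in A -> b \in B -> b' \in B -> c \in C ->
  E a b c -> E a b' c -> b = b'.
Proof.
move=> Aa Bb Bb' Cc Eb Eb'; apply/eqP/negPn/negP => ne.
have [rA rB rC] := cyclic_rules; have [c' Cc' cc'] := exists_other c (cyc_cardC cyc).
have Nb : b \in N E a c by rewrite inE (sysC23 H).
have Nb' : b' \in N E a c by rewrite inE (sysC23 H).
have Nc' : c' \in N E a c by rewrite inE (Erot H) rC.
by have := N_indep H Nb Nb' Nc'; rewrite rB // Cc'.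
Qed.

(** Otherwise, for another [b'] in [B], the edge [aa'b'] lies inside [N E b c]. *)
Lemma colour_inj_l a a' b c : a \in A -> a' \in A -> b \in B -> c \in C ->
  E a b c -> E a' b c -> a = a'.
Proof.
move=> Aa Aa' Bb Cc Ea Ea'; apply/eqP/negPn/negP => ne.
have [rA rB rC] := cyclic_rules; have [b' Bb' bb'] := exists_other b (cyc_cardB cyc).
have Na : a \in N E b c by rewrite inE -(Erot H).
have Na' : a' \in N E b c by rewrite inE -(Erot H).
have Nb' : b' \in N E b c by rewrite inE (sysC23 H) rB.
by have := N_indep H Na Na' Nb'; rewrite rA // Bb'.
Qed.

End Colouring.

(** * Passage between 3-graphs and edge relations *)

Lemma exists_set3 (V : finType) (e : {set V}) : #|e| = 3 ->
  exists x y z, [/\ e = [set x; y; z], x != y, y != z & x != z].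
Proof.
move=> e3; have /card_gt2P[x [y [z [[ex ey ez] [xy yz zx]]]]] : 2 < #|e| by rewrite e3.
have xz : x != z by rewrite eq_sym.
exists x, y, z; split=> //; apply/esym/eqP; rewrite eqEcard e3 card_set3 // andbT.
by apply/subsetP => u; rewrite !inE => /orP[/orP[]|] /eqP->.
Qed.

Section Graph.

Variables (V : finType) (G : graph3 V).

Lemma codegree_le x y : x != y ->
  codegree G x y <= #|[set z | triple (edges G) x y z]|.
Proof.
move=> xy; apply: leq_trans (leq_imset_card (fun z => [set x; y; z]) _).
apply/subset_leq_card/subsetP => e; rewrite inE => /andP[Ge sub].
have e3 := edges_card3 Ge.
have /set0Pn[z] : e :\: [set x; y] != set0.
  by rewrite -card_gt0 cardsDS // cards2 xy e3.
rewrite !inE negb_or => /andP[/andP[zx zy] ez].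
have -> : e = [set x; y; z].
  apply/esym/eqP; rewrite eqEcard subUset sub sub1set ez /=.
  by rewrite e3 card_set3 // eq_sym.
apply: imset_f; rewrite inE /triple.
have -> // : [set x; y; z] = e.
apply/eqP; rewrite eqEcard subUset sub sub1set ez /=.
by rewrite e3 card_set3 // eq_sym.
Qed.

Lemma delta2_le x y : x != y -> delta2 G <= codegree G x y.
Proof.
move=> xy; rewrite /delta2; have := mem_index_enum (x, y).
elim: (index_enum _) => // p s IHs; rewrite inE big_cons => /predU1P[<- | sxy].
  by rewrite /= xy geq_minl.
by case: ifP => _; [apply: leq_trans (geq_minr _ _) _ | ]; exact: IHs.
Qed.

Lemma F32_free_triples : free_of F32 G ->
  forall x y a b c, triple (edges G) x y a -> triple (edges G) x y b ->
    triple (edges G) x y c -> triple (edges G) a b c -> False.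
Proof.
move=> free x y a b c Ea Eb Ec Eabc; apply: free.
have ne u v w : triple (edges G) u v w -> [/\ u != v, v != w & u != w].
  by move=> /edges_card3/set3_neq.
have [[xy ya xa] [_ yb xb]] := (ne _ _ _ Ea, ne _ _ _ Eb).
have [[_ yc xc] [ab bc ac]] := (ne _ _ _ Ec, ne _ _ _ Eabc).
(* The labels 1 to 5 of [F32] go to [x], [y], [a], [b], [c] in this order. *)
pose s := [:: x; y; a; b; c].
have us : uniq s by rewrite /= !inE !negb_or xy xa xb xc ya yb yc ab ac bc.
exists (fun i : 'I_5 => nth x s i) => [i j /eqP | e].
  by rewrite nth_uniq // => /eqP/val_inj.
by rewrite !inE -!orbA => /or4P[] /eqP->;
  rewrite !imsetU !imset_set1 /lab5 !inordK.
Qed.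

Lemma graph_system m : #|V| = 3 * m -> free_of F32 G -> delta2 G = m ->
  F32_free_system (triple (edges G)) m.
Proof.
move=> cardV free delta; split=> //.
- by move=> x y z; rewrite /triple (setUC [set x]).
- by move=> x y z; rewrite /triple setUAC.
- by move=> x z; apply/negP => /edges_card3/set3_neq[]; rewrite eqxx.
- exact: F32_free_triples.
- move=> x y xy; rewrite -delta; apply: leq_trans (codegree_le xy).
  exact: delta2_le.
Qed.

Lemma in_T_family_of_cyclic m A B C : 1 < m ->
    F32_free_system (triple (edges G)) m ->
    cyclic_system (triple (edges G)) m A B C ->
  in_T_family m G.
Proof.
move=> m1 H cyc; set E := triple (edges G) in H cyc.
pose gA i := enum_val (cast_ord (esym (cyc_cardA cyc)) i).
pose gB i := enum_val (cast_ord (esym (cyc_cardB cyc)) i).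
pose gC i := enum_val (cast_ord (esym (cyc_cardC cyc)) i).
have [AgA BgB CgC] : [/\ forall i, gA i \in A, forall i, gB i \in B &
    forall i, gC i \in C].
  by split=> i; exact: enum_valP.
have injA : injective gA by move=> i j /enum_val_inj/cast_ord_inj.
have injB : injective gB by move=> i j /enum_val_inj/cast_ord_inj.
have injC : injective gC by move=> i j /enum_val_inj/cast_ord_inj.
pose g (v : vert m) := match v with
  | inl (inl i) => gA i | inl (inr i) => gB i | inr i => gC i end.
have memA v : (g v \in A) = (v \in partA m).
  rewrite in_partA; case: v => [[i|i]|i] /=; first exact: AgA.
    by rewrite (disjointFl (cyc_dAB cyc) (BgB i)).
  by rewrite (disjointFr (cyc_dCA cyc) (CgC i)).
have memB v : (g v \in B) = (v \in partB m).
  rewrite in_partB; case: v => [[i|i]|i] /=; last 2 first.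
  - exact: BgB.
  - by rewrite (disjointFl (cyc_dBC cyc) (CgC i)).
  - by rewrite (disjointFr (cyc_dAB cyc) (AgA i)).
have memC v : (g v \in C) = (v \in partC m).
  rewrite in_partC; case: v => [[i|i]|i] /=; last exact: CgC.
    by rewrite (disjointFl (cyc_dCA cyc) (AgA i)).
  by rewrite (disjointFr (cyc_dBC cyc) (BgB i)).
have inj_g : injective g.
  move=> u v eq_g.
  have eqA := memA u; rewrite eq_g memA in eqA.
  have eqB := memB u; rewrite eq_g memB in eqB.
  move: eqA eqB eq_g; rewrite !in_partA !in_partB.
  by case: u => [[i|i]|i]; case: v => [[j|j]|j] //= _ _;
    first [move/injA-> | move/injB-> | move/injC->].
have bij_g : bijective g.
  by apply: inj_card_bij inj_g _; rewrite (sysV H) !card_sum !card_ord; lia.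
(* The default [e.1] is only some element of ['I_m]; by [exists_colour] the choice always
   succeeds. *)
pose phi e := odflt e.1 [pick k | E (gA e.1) (gB e.2) (gC k)].
have phiE i j k : E (gA i) (gB j) (gC k) = (k == phi (i, j)).
  rewrite /phi; case: pickP => [l Eijl | none] /=.
    have [c Cc uniq_c] := exists_colour H cyc m1 (AgA i) (BgB j).
    by move: Eijl; rewrite !uniq_c // => /eqP <-; rewrite (inj_eq injC).
  have [c Cc uniq_c] := exists_colour H cyc m1 (AgA i) (BgB j).
  have [v gv] : exists v, g v = c by case: bij_g => f _ gf; exists (f c).
  move: Cc; rewrite -gv memC in_partC; case: v gv => // l /= gl _.
  by have := none l; rewrite /= uniq_c ?CgC // gl eqxx.
have phi_edge e : E (gA e.1) (gB e.2) (gC (phi e)).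
  by case: e => i j; rewrite phiE.
exists phi.
  move=> [i j] [i' j'] ne [/= eq1 | /= eq2] eq_phi; apply: ne.
    have := phi_edge (i', j'); have := phi_edge (i, j); rewrite eq_phi /= -eq1 => e1 e2.
    by have /injB -> := colour_inj_r H cyc m1 (AgA _) (BgB _) (BgB _) (CgC _) e1 e2.
  have := phi_edge (i', j'); have := phi_edge (i, j); rewrite eq_phi /= -eq2 => e1 e2.
  by have /injA -> := colour_inj_l H cyc m1 (AgA _) (AgA _) (BgB _) (CgC _) e1 e2.
have [rA rB rC] := cyclic_rules cyc; have [rA' rB' rC'] := Tphi_rules phi.
have gE x y z : x != y -> y != z -> x != z ->
    E (g x) (g y) (g z) = triple (Tphi_edges phi) x y z.
  apply: (@cyclic_rule_ext _ (fun x y z => E (g x) (g y) (g z)) _ _ _ _ (parts_cover m)) => //.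
  - by move=> *; exact: (sysC12 H).
  - by move=> *; exact: (sysC23 H).
  - by move=> u v w; rewrite /triple (setUC [set u]).
  - by move=> u v w; rewrite /triple setUAC.
  - by move=> u v pu pv uv w; rewrite rA ?memA ?memB // (inj_eq inj_g).
  - by move=> u v pu pv uv w; rewrite rB ?memB ?memC // (inj_eq inj_g).
  - by move=> u v pu pv uv w; rewrite rC ?memC ?memA // (inj_eq inj_g).
  move=> u v w /imsetP[i _ ->] /imsetP[j _ ->] /imsetP[k _ ->].
  by rewrite Tphi_transversal /= phiE.
have edgeE (e : {set vert m}) : (e \in Tphi_edges phi) = (g @: e \in edges G).
  have [/exists_set3[x [y [z [-> xy yz xz]]]] | ne3] := eqVneq #|e| 3.
    by rewrite -[LHS]/(triple _ _ _ _) -gE // !imsetU !imset_set1.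
  transitivity false; last apply/esym; apply: contraNF ne3.
    by move=> /Tphi_card3 ->.
  by move=> /edges_card3; rewrite card_imset // => ->.
have [f fg gf] := bij_g; exists f; first by exists g.
move=> e; rewrite /= edgeE -imset_comp.
have -> // : [set (g \o f) x | x in e] = e.
by rewrite -[RHS]imset_id; apply: eq_imset => x; exact: gf.
Qed.

End Graph.

Theorem theorem4p13 :
  exists n0 : nat, forall n m : nat, n = 3 * m -> n0 <= n ->
    forall (V : finType) (G : graph3 V),
      #|V| = n -> free_of F32 G -> delta2 G = m -> in_T_family m G.
Proof.
have [k kE] : exists k, k = 8 * (64 * 64) * 3000 by eexists.
have k_gt0 : 0 < k by lia.
have k_big : 8 * (64 * 64) * 3000 <= k by rewrite kE leqnn.
(* The power excludes a one-element stable set; the term [12 * k] gives [4 * k <= m]. *)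
exists ((72 * (k * k)) ^ (4 * k) + 12 * k).+1 => n m -> le_n V G cardV free delta.
have H := graph_system cardV free delta.
have [A [B [C cyc]]] : exists A B C, cyclic_system (triple (edges G)) m A B C.
  by apply: (cyclic_system_of_large H k_gt0 k_big); move: le_n; lia.
by apply: (in_T_family_of_cyclic _ H cyc); move: le_n k_gt0; lia.
Qed.
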